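(* If the alternating group $A_n$ is a doubly Hurwitz Beauville group, then $n\ge 168$.
   Context: A generating triple of type $(2,3,7)$ (a Hurwitz triple) for a finite group $G$ is a triple $(x,y,z)$ of elements of $G$ of orders $2,3,7$ respectively, with $xyz=1$ and $G=\langle x,y,z\rangle$. A finite group $G$ is a doubly Hurwitz Beauville group (dHB group) if it has two generating triples $(x_1,y_1,z_1)$ and $(x_2,y_2,z_2)$ of type $(2,3,7)$ such that no non-identity power of $x_1$, $y_1$ or $z_1$ is conjugate in $G$ to a power of $x_2$, $y_2$ or $z_2$. *)

(* Defs.v *)
From mathcomp Require Import all_boot all_fingroup.

Set Implicit Arguments.
Unset Strict Implicit.
Unset Printing Implicit Defensive.

Local Open Scope group_scope.

Definition hurwitz_triple (gT : finGroupType) (G : {group gT}) (x y z : gT) :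
    Prop :=
  [/\ [/\ x \in G, y \in G & z \in G],
      [/\ #[x] = 2, #[y] = 3 & #[z] = 7],
      x * y * z = 1
    & <<[set x; y; z]>> = G].

(* Natural exponents give all powers, since every element has finite order;
   u ^: G is the conjugacy class of u under G. *)
Definition powers_not_conjugate (gT : finGroupType) (G : {group gT})
    (S T : {set gT}) : Prop :=
  forall a b : gT, a \in S -> b \in T ->
  forall i j : nat, a ^+ i != 1 -> b ^+ j \notin (a ^+ i) ^: G.

Definition doubly_hurwitz_beauville (gT : finGroupType) (G : {group gT}) :
    Prop :=
  exists x1 y1 z1 x2 y2 z2 : gT,
    [/\ hurwitz_triple G x1 y1 z1,
        hurwitz_triple G x2 y2 z2
      & powers_not_conjugate G [set x1; y1; z1] [set x2; y2; z2]].

(* Main.v *)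
Require Import Defs.
From mathcomp Require Import all_boot all_fingroup all_solvable.
From mathcomp Require Import zify.

(** Let x, y, z have a, b, c fixed points. Riemann-Hurwitz (in the combinatorial
    form of Ree's theorem) bounds the total number of cycles of x, y and z by
    n + 2, hence 21a + 28b + 36c <= n + 84. Elements of the same prime order in
    A_n with equally many fixed points are conjugate in S_n, and even in A_n
    when an odd permutation centralises one of them. So c1 <> c2, unless n is 7
    or 8, where the bound forces a1 = a2 = 3, respectively b1 = b2 = 2, and the
    two x's or y's are conjugate. As c1 and c2 are congruent to n modulo 7, one
    of them is at least 7, and n >= 36 * 7 - 84 = 168. *)

Set Implicit Arguments.
Unset Strict Implicit.
Unset Printing Implicit Defensive.

Local Open Scope group_scope.

(** Elements are matched by their ranks in the two enumerations. The default [d] is never returned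
    on [A], since ranks in [A] stay below the size of [B]. *)
Lemma leq_card_injection (aT rT : finType) (d : rT) (A : {set aT}) (B : {set rT}) :
  #|A| <= #|B| ->
  exists2 f : aT -> rT, {in A &, injective f} & {in A, forall x, f x \in B}.
Proof.
move=> leAB; pose f x := nth d (enum B) (index x (enum A)).
have ltB x : x \in A -> index x (enum A) < size (enum B).
  by move=> xA; rewrite -cardE (leq_trans _ leAB) // cardE index_mem mem_enum.
exists f => [x y xA yA /eqP | x xA]; last by rewrite -mem_enum mem_nth ?ltB.
rewrite nth_uniq ?ltB ?enum_uniq // => /eqP/(congr1 (nth x (enum A))).
by rewrite !nth_index ?mem_enum.
Qed.

(** * Stable sets, cycle counts and Ree's inequality *)

Section Permutations.
Variable T : finType.
Implicit Types (s t x y z : {perm T}) (A R : {set T}).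

Lemma astabs_permE s A : (s \in 'N(A | 'P)) = [forall u in A, s u \in A].
Proof.
apply/idP/forall_inP=> [sA u uA | sA]; first by rewrite -apermE (astabs_act _ sA).
by rewrite !inE; apply/subsetP=> u uA; rewrite inE; apply: sA.
Qed.

Lemma porbit_stable s u : s \in 'N(porbit s u | 'P).
Proof.
rewrite astabs_permE; apply/forall_inP=> v /porbitP[i ->].
by rewrite -permM -expgSr mem_porbit.
Qed.

Lemma porbit_sub_stable s A u v :
  s \in 'N(A | 'P) -> u \in A -> v \in porbit s u -> v \in A.
Proof.
by move=> sA uA /porbitP[i ->]; rewrite -apermE (astabs_act _ (groupX i sA)).
Qed.

Lemma tperm_stable a b A : (a \in A) = (b \in A) -> tperm a b \in 'N(A | 'P).
Proof.
move=> ab; rewrite astabs_permE; apply/forall_inP=> u.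
by case: tpermP => // ->; rewrite ab.
Qed.

Lemma disjoint_setU1 a A R :
  [disjoint A & a |: R] = (a \notin A) && [disjoint A & R].
Proof.
by rewrite ![[disjoint A & _]]disjoint_sym !disjoints_subset subUset sub1set inE.
Qed.

Lemma card_porbits_le s : #|porbits s| <= #|T|.
Proof. exact: leq_imset_card. Qed.

Lemma card_porbits1 : #|porbits (1 : {perm T})| = #|T|.
Proof.
apply: card_imset => u v /eqP; rewrite eq_porbit_mem => /porbitP[i ->].
by rewrite expg1n perm1.
Qed.

(** A cycle is itself a stable set, so it passes through a point of [R]. This serves the case
    [t = 1] of Ree's inequality. *)
Lemma card_porbits_hit R s :
  (forall A, A != set0 -> s \in 'N(A | 'P) -> ~~ [disjoint A & R]) ->
  #|porbits s| <= #|R|.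
Proof.
move=> hitR; apply: leq_trans (leq_imset_card (porbit s) R).
apply/subset_leq_card/subsetP=> _ /imsetP[u _ ->].
have /pred0Pn[v /andP[/= vu vR]] : ~~ [disjoint porbit s u & R].
  apply: hitR (porbit_stable s u).
  by apply/set0Pn; exists u; apply: porbit_id.
by apply/imsetP; exists v => //; apply/eqP; rewrite eq_sym eq_porbit_mem.
Qed.

Lemma porbits_tperm a b s : a != b ->
  #|porbits (tperm a b * s)| =
    if a \in porbit s b then #|porbits s|.+1 else #|porbits s|.-1.
Proof.
move=> ab; have /= := porbits_mul_tperm s a b; rewrite ab.
by case: ifP => _ /=; lia.
Qed.

(* The set R, required to meet every nonempty set stable under s and t, stands
   for a set of representatives of the orbits of <s, t>. The induction splits a
   transposition off t; if this separates its two points a and b, then adding one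
   of them to R restores the hypothesis, and the number of cycles of t * s
   drops. *)
Lemma card_porbits_Ree R s t :
    (forall A, A != set0 -> s \in 'N(A | 'P) -> t \in 'N(A | 'P) ->
      ~~ [disjoint A & R]) ->
  #|porbits t| + #|porbits s| + #|porbits (t * s)| <= #|T| + #|R|.*2.
Proof.
have [k] := ubnP (#|T| - #|porbits t|); elim: k => // k IHk in R t *.
rewrite ltnS => le_k hitR.
case: (pickP (fun u => t u != u)) => [a ta | t1]; last first.
  have {}t1: t = 1 by apply/permP=> u; rewrite perm1; apply/eqP/negbFE/t1.
  have := @card_porbits_hit R s; rewrite t1 mul1g card_porbits1.
  move=> /(_ _)/wrap[]; last by lia.
  by move=> A A0 sA; apply: hitR; rewrite // t1 group1.
(* With this [b], the permutation [t'] fixes [b]: one cycle of [t] is split in two, which lowers the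
   induction measure. *)
pose b := t a; pose tau := tperm a b; pose t' := tau * t.
have ab : a != b by rewrite eq_sym.
have t'E : t = tau * t' by rewrite /t' mulgA tperm2 mul1g.
have ct' : #|porbits t'| = #|porbits t|.+1.
  by rewrite porbits_tperm // porbit_sym (mem_porbit t 1).
have lt_k : #|T| - #|porbits t'| < k by have := card_porbits_le t'; lia.
have ct's := porbits_tperm (t' * s) ab; rewrite mulgA -t'E in ct's.
have tA A : t' \in 'N(A | 'P) -> (a \in A) = (b \in A) -> t \in 'N(A | 'P).
  by move=> t'A abA; rewrite t'E groupM // tperm_stable.
(* If no stable set separates [a] and [b], then [R] still serves for [t'], and the extra cycle of
   [t'] pays for the at most one cycle that [t * s] has more than [t' * s]. *)
have [/existsP[A0 /and3P[sA0 t'A0 abA0]] | sep] := boolP [exists A : {set T},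
  [&& s \in 'N(A | 'P), t' \in 'N(A | 'P) & (a \in A) != (b \in A)]]; last first.
  have IH := IHk R t' lt_k; rewrite ct' in IH; rewrite ct's.
  apply: leq_trans (IH _); first by case: ifP; lia.
  move=> A nA sA t'A; apply: hitR => //; apply: tA => //.
  by apply: contraNeq sep => abA; apply/existsP; exists A; rewrite sA t'A.
have nab : a \in porbit (t' * s) b = false.
  apply: contraNF abA0 => ab'; apply/eqP; have tsA0 := groupM t'A0 sA0.
  by apply/idP/idP=> /(porbit_sub_stable tsA0)->; rewrite // porbit_sym.
have [R' cR' hitR'] : exists2 R' : {set T}, #|R'| <= #|R|.+1 &
  forall A, A != set0 -> s \in 'N(A | 'P) -> t' \in 'N(A | 'P) ->
    ~~ [disjoint A & R'].
  (* Adding [a] works unless some stable [A1] misses [a] and [R]. Then [b] works: a stable [A]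
     missing [b] and [R] would contain [a], and [A1] contains [b], so [A :|: A1] would be [t]-stable
     and miss [R]. *)
  have [/existsP[A1 /and5P[nA1 sA1 tA1 dA1 aA1]] | none] := boolP [exists A : {set T},
    [&& A != set0, s \in 'N(A | 'P), t' \in 'N(A | 'P), [disjoint A & R]
      & a \notin A]]; last first.
    exists (a |: R); first by rewrite cardsU1 -add1n leq_add2r leq_b1.
    move=> A nA sA t'A; apply: contra none => dA; apply/existsP; exists A.
    by move: dA; rewrite disjoint_setU1 nA sA t'A => /andP[-> ->].
  exists (b |: R); first by rewrite cardsU1 -add1n leq_add2r leq_b1.
  move=> A nA sA t'A; rewrite disjoint_setU1.
  apply/negP=> /andP[bA dA].
  have sepR B : B != set0 -> s \in 'N(B | 'P) -> t' \in 'N(B | 'P) ->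
      [disjoint B & R] -> (a \in B) != (b \in B).
    by move=> nB sB t'B; apply: contraL => /eqP abB; apply: hitR => //; apply: tA.
  have aA : a \in A by have := sepR A nA sA t'A dA; rewrite (negPf bA); case: (a \in A).
  have bA1 : b \in A1.
    by have := sepR A1 nA1 sA1 tA1 dA1; rewrite (negPf aA1); case: (b \in A1).
  have : (a \in A :|: A1) != (b \in A :|: A1); last by rewrite !inE aA bA1 orbT.
  apply: sepR.
  - by apply/set0Pn; exists a; rewrite inE aA.
  - by rewrite (subsetP (astabsU _ _ _)) // inE sA.
  - by rewrite (subsetP (astabsU _ _ _)) // inE t'A.
  - by rewrite disjoints_subset subUset -!disjoints_subset dA.
have := IHk R' t' lt_k hitR'.
move: ct's; rewrite ct' nab => ->; have := card_porbits_le (t'*s).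
(* Positivity makes the predecessor in [ct's] a true subtraction. *)
have : 0 < #|porbits (t' * s)|.
  by apply/card_gt0P; exists (porbit (t' * s) a); apply: imset_f.
lia.
Qed.

(** * Cycle types, conjugators and odd centralisers *)

Lemma expg_perm_eq s u i j :
  ((s ^+ i) u == (s ^+ j) u) = (i == j %[mod #|porbit s u|]).
Proof.
set m := #|_|; have m0 : 0 < m by rewrite lt0n card_porbit_neq0.
have modE k : (s ^+ k) u = nth u (traject s u m) (k %% m).
  rewrite nth_traject ?ltn_mod // {1}(divn_eq k m) addnC !permX iterD.
  by congr iter; elim: (k %/ m) => // q IHq; rewrite mulSn iterD IHq iter_porbit.
by rewrite !modE nth_uniq ?size_traject ?ltn_mod ?uniq_traject_porbit.
Qed.

(** The conjugator sends [(s ^+ k) r] to [(t ^+ k) r'], where [r] and [r'] are the chosen points of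
    [C] and [F C]. Equal lengths make this well defined and injective on each cycle. *)
Lemma conjg_perm_porbits s t (F : {set T} -> {set T}) :
    {in porbits s, forall C, F C \in porbits t} ->
    {in porbits s, forall C, #|F C| = #|C|} ->
    {in porbits s &, injective F} ->
  exists g, s ^ g = t.
Proof.
move=> tF cardF injF.
case: (pickP T) => [u0 _ | T0]; last by exists 1; apply/permP=> u; have := T0 u.
pose rep (C : {set T}) := odflt u0 [pick v in C].
have repP x C : C \in porbits x -> porbit x (rep C) = C.
  move=> /imsetP[u _ ->]; rewrite /rep; case: pickP => [v | /(_ u)] /=.
    by rewrite -eq_porbit_mem => /eqP.
  by rewrite porbit_id.
have Os u : porbit s u \in porbits s by apply: imset_f.
have kP u : exists k, (s ^+ k) (rep (porbit s u)) == u.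
  have /porbitP[k {2}->] : u \in porbit s (rep (porbit s u)).
    by rewrite repP ?porbit_id.
  by exists k.
pose k u := xchoose (kP u); have kE u : (s ^+ k u) (rep (porbit s u)) = u.
  exact/eqP/(xchooseP (kP u)).
pose g u := (t ^+ k u) (rep (F (porbit s u))).
have gE u i j : ((t ^+ i) (rep (F (porbit s u))) == (t ^+ j) (rep (F (porbit s u))))
    = ((s ^+ i) (rep (porbit s u)) == (s ^+ j) (rep (porbit s u))).
  by rewrite !expg_perm_eq !repP ?cardF ?tF.
have inj_g : injective g.
  move=> u v eq_g; have Ouv : porbit s u = porbit s v.
    apply: injF => //; have := congr1 (porbit t) eq_g.
    by rewrite /g !porbit_perm !repP ?tF.
  by apply/eqP; rewrite -[u]kE -[v]kE Ouv -gE -{1}Ouv; apply/eqP.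
exists (perm inj_g); apply/permP=> v; rewrite -[v](permKV (perm inj_g)).
set u := _ v; rewrite permJ !permE /g -permM -expgSr.
have Osu : porbit s (s u) = porbit s u by exact: (porbit_perm s 1 u).
by apply/eqP; rewrite Osu gE -{1}Osu kE expgSr permM kE.
Qed.

(* If s has cycles (a, s a, ...) and (b, s b, ...) of the same odd length m, then
   the product of the m transpositions (s^i a  s^i b) is odd and centralises s. *)
Lemma odd_centralizer s a b : a \notin porbit s b ->
    #|porbit s a| = #|porbit s b| -> odd #|porbit s a| ->
  exists2 h, h ^ s = h & odd_perm h.
Proof.
move=> ab; set m := #|_| => /esym mb odd_m.
have neq_ab : a != b by apply: contraNneq ab => ->; apply: porbit_id.
pose tau := tperm a b; exists (\prod_(0 <= i < m) tau ^ (s ^+ i)); last first.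
  suff -> : odd_perm (\prod_(0 <= i < m) tau ^ (s ^+ i)) = odd m by [].
  elim: (m) => [|k IHk]; first by rewrite big_geq // odd_perm1.
  by rewrite big_nat_recr //= odd_permM IHk odd_permJ odd_tperm neq_ab addbT.
have m0 : 0 < m by case: (m) odd_m.
have smE u : #|porbit s u| = m -> (s ^+ m) u = u.
  by move=> um; rewrite permX -um iter_porbit.
have taum : tau ^ (s ^+ m) = tau by rewrite tpermJ !smE.
(* Conjugation by [s] turns each factor into the next and the last into the first, so it remains to
   move [tau] past the other factors. *)
rewrite -[LHS]/(conjg _ s) (big_morph (conjg^~ s) (fun x y => conjMg x y s) (conj1g s)).
under eq_bigr => i _ do rewrite -conjgM -expgSr.
rewrite -(big_add1 _ _ 0 m.+1 xpredT (fun i => tau ^ (s ^+ i))) big_nat_recr //= taum.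
rewrite [RHS]big_ltn // expg0 conjg1; apply/cent1P.
rewrite big_nat; apply: group_prod => i /andP[i0 im]; apply/cent1P/commgP/conjg_fixP.
(* For [0 < i < m] the conjugate transposition shares no point with [tau]. *)
have fixed u : #|porbit s u| = m -> (s ^+ i) u != u.
  move=> um; have := expg_perm_eq s u i 0.
  by rewrite perm1 um mod0n modn_small // => ->; lia.
have nb : (s ^+ i) a != b by apply: contraNneq ab => <-; rewrite porbit_sym mem_porbit.
have na : (s ^+ i) b != a by apply: contraNneq ab => <-; rewrite mem_porbit.
by rewrite tpermJ tpermJ !tpermD // eq_sym // fixed.
Qed.

(** * Permutations of prime order: counting and conjugacy *)

Definition nfix s := #|[set u | s u == u]|.

Lemma card_porbit1 s u : (#|porbit s u| == 1%N) = (s u == u).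
Proof.
have := expg_perm_eq s u 1 0; rewrite expg1 expg0 perm1 => ->.
have := card_porbit_neq0 s u; case: #|_| => [|[|m]] // _; by rewrite modn_small.
Qed.

Section PrimeOrder.
Variables (p : nat) (s : {perm T}).
Hypotheses (p_pr : prime p) (sp1 : s ^+ p = 1).

Lemma card_porbit_prime u : #|porbit s u| = if s u == u then 1%N else p.
Proof.
rewrite -card_porbit1; case: eqP => // m1.
have: #|porbit s u| %| p.
  by have := expg_perm_eq s u p 0; rewrite sp1 expg0 eqxx mod0n /dvdn => <-.
by case/primeP: p_pr => _ H /H /orP[]/eqP.
Qed.

Lemma card_porbits1_prime : #|[set C in porbits s | #|C| == 1%N]| = nfix s.
Proof.
rewrite /nfix -(card_imset _ (@set1_inj T)); apply: eq_card => C; rewrite inE.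
apply/andP/imsetP=> [[/imsetP[u _ ->]] | [u]].
  rewrite card_porbit1 => su; exists u; first by rewrite inE.
  apply/eqP; rewrite eq_sym eqEcard sub1set porbit_id cards1.
  by rewrite card_porbit_prime su.
rewrite inE => su ->; suff <- : porbit s u = [set u].
  by rewrite imset_f // card_porbit1.
apply/eqP; rewrite eq_sym eqEcard sub1set porbit_id cards1.
by rewrite card_porbit_prime su.
Qed.

(** Adding [p.-1] for each fixed point gives every cycle, trivial or not, the weight [p]. *)
Lemma card_porbits_prime : (p * #|porbits s| = #|T| + p.-1 * nfix s)%N.
Proof.
have acts_s : [acts <[s]>, on [set: T] | 'P].
  by apply/actsP=> a _ u; rewrite !inE.
have := acts_sum_card_orbit acts_s; rewrite -porbitE cardsT => <-.
have -> : porbit s @: [set: T] = porbits s.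
  by apply/setP=> C; apply/imsetP/imsetP=> -[u _ ->]; exists u.
rewrite -card_porbits1_prime mulnC [(p.-1 * _)%N]mulnC -!sum_nat_const.
rewrite [X in _ = _ + X](eq_bigl
  (fun C => (C \in porbits s) && (#|C| == 1%N))); last first.
  by move=> C; rewrite inE.
rewrite big_mkcondr -big_split /=; apply: eq_bigr => _ /imsetP[u _ ->].
rewrite card_porbit1 card_porbit_prime; case: ifP => _; last by rewrite addn0.
by rewrite add1n prednK ?prime_gt0.
Qed.

Lemma nfix_le_porbits : nfix s <= #|porbits s|.
Proof.
rewrite -card_porbits1_prime; apply/subset_leq_card/subsetP=> C.
by rewrite inE => /andP[].
Qed.

Lemma card_porbits_in C : C \in porbits s -> #|C| != 1%N -> #|C| = p.
Proof.
by move=> /imsetP[u _ ->]; rewrite card_porbit1 card_porbit_prime => /negPf->.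
Qed.

(** Two fixed points, or two [p]-cycles with [p] odd, can be swapped; the second alternative says
    that at least two cycles are nontrivial. *)
Lemma odd_centralizer_prime :
    1 < nfix s \/ odd p /\ (nfix s).+1 < #|porbits s| ->
  exists2 h, h ^ s = h & odd_perm h.
Proof.
case=> [/card_gt1P[a [b [sa sb ab]]] | [odd_p lt1]].
  move: sa sb; rewrite !inE => sa sb.
  have ma : #|porbit s a| = 1%N by rewrite card_porbit_prime sa.
  have mb : #|porbit s b| = 1%N by rewrite card_porbit_prime sb.
  apply: (@odd_centralizer s a b); rewrite ?ma //.
  apply: contra ab => /porbitP[i ->]; rewrite -{2}[b]perm1 -(expg0 s).
  by rewrite expg_perm_eq mb !modn1.
have /card_gt1P[A [B [PA PB AB]]] :
    1 < #|porbits s :\: [set C in porbits s | #|C| == 1%N]|.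
  rewrite cardsDS ?card_porbits1_prime; first by lia.
  by apply/subsetP=> C; rewrite inE => /andP[].
move: PA PB; rewrite !inE => /andP[nA PA] /andP[nB PB].
rewrite PA in nA; rewrite PB in nB.
have [[u _ Au] [v _ Bv]] := (imsetP PA, imsetP PB).
have cA := card_porbits_in PA nA; have cB := card_porbits_in PB nB.
rewrite {}Au {}Bv in AB cA cB.
by apply: (@odd_centralizer s u v); rewrite ?cA ?cB // -eq_porbit_mem.
Qed.
End PrimeOrder.

(** Equal numbers of fixed points force equal numbers of [p]-cycles; the two kinds of cycles are
    then matched separately. *)
Lemma conjg_perm_prime p s t : prime p -> s ^+ p = 1 -> t ^+ p = 1 ->
  nfix s = nfix t -> exists g, s ^ g = t.
Proof.
move=> p_pr sp tp eq_fix.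
pose P1 x := [set C in porbits x | #|C| == 1%N]; pose P2 x := porbits x :\: P1 x.
have card2 x : x ^+ p = 1 -> #|P2 x| = #|porbits x| - nfix x.
  move=> xp; rewrite cardsDS ?(card_porbits1_prime p_pr xp) //.
  by apply/subsetP=> C; rewrite inE => /andP[].
have eq_por : #|porbits s| = #|porbits t|.
  apply/eqP; rewrite -(eqn_pmul2l (prime_gt0 p_pr)) (card_porbits_prime p_pr sp).
  by rewrite (card_porbits_prime p_pr tp) eq_fix.
have [f1 inj1 f1t] : exists2 f : {set T} -> {set T},
    {in P1 s &, injective f} & {in P1 s, forall C, f C \in P1 t}.
  by apply: (leq_card_injection set0); rewrite !(@card_porbits1_prime p) ?eq_fix.
have [f2 inj2 f2t] : exists2 f : {set T} -> {set T},
    {in P2 s &, injective f} & {in P2 s, forall C, f C \in P2 t}.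
  by apply: (leq_card_injection set0); rewrite !card2 // eq_por eq_fix.
have PE x C : (C \in P2 x) = (#|C| != 1%N) && (C \in porbits x).
  by rewrite !inE; case: (C \in porbits x); rewrite ?andbF ?andbT.
have F1 C : C \in porbits s -> #|C| == 1%N -> f1 C \in porbits t /\ #|f1 C| = 1%N.
  move=> sC C1; have: f1 C \in P1 t by apply: f1t; rewrite inE sC.
  by rewrite inE => /andP[-> /eqP].
have F2 C : C \in porbits s -> #|C| != 1%N -> f2 C \in porbits t /\ #|f2 C| = p.
  move=> sC C1; have: f2 C \in P2 t by apply: f2t; rewrite PE sC C1.
  by rewrite PE => /andP[nC tC]; rewrite tC (card_porbits_in p_pr tp tC nC).
have p1 : p != 1%N by apply: contraTneq p_pr => ->.
apply: (@conjg_perm_porbits s t (fun C => if #|C| == 1%N then f1 C else f2 C)).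
- by move=> C sC; case: ifPn => [/(F1 C sC)[]|/(F2 C sC)[]].
- move=> C sC; case: ifPn => [C1|C1].
    by have [_ ->] := F1 C sC C1; rewrite (eqP C1).
  by have [_ ->] := F2 C sC C1; rewrite (card_porbits_in p_pr sp sC C1).
move=> C D sC sD; case: ifPn => C1; case: ifPn => D1.
- by apply: inj1; rewrite inE ?sC ?sD.
- move=> E; have [_] := F1 C sC C1; have [_] := F2 D sD D1.
  by rewrite -E => -> /eqP; rewrite (negPf p1).
- move=> E; have [_] := F2 C sC C1; have [_] := F1 D sD D1.
  by rewrite -E => -> /eqP; rewrite eq_sym (negPf p1).
- by apply: inj2; rewrite PE ?sC ?sD ?C1 ?D1.
Qed.

(** An odd conjugator is corrected by an odd left factor that centralises [s]. *)
Lemma Alt_class_prime p s t : prime p -> s ^+ p = 1 -> t ^+ p = 1 ->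
    nfix s = nfix t -> 1 < nfix s \/ odd p /\ (nfix s).+1 < #|porbits s| ->
  t \in s ^: 'Alt_T.
Proof.
move=> p_pr sp tp eq_fix big; have [g gE] := conjg_perm_prime p_pr sp tp eq_fix.
have [h hs odd_h] := odd_centralizer_prime p_pr sp big.
have sh : s ^ h = s.
  by apply/conjg_fixP/commgP/commute_sym/commgP/conjg_fixP.
case odd_g: (odd_perm g); last by rewrite -gE memJ_class // Alt_even odd_g.
by rewrite -gE -{1}sh -conjgM memJ_class // Alt_even odd_permM odd_h odd_g.
Qed.

(** * The cycle bound for generators of the alternating group *)

Lemma Alt_stable_setT A : 2 < #|T| -> A != set0 -> 'Alt_T \subset 'N(A | 'P) ->
  A = setT.
Proof.
move=> T3 /set0Pn[u uA] AltA; apply/setP=> v; rewrite inE.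
have [-> // | vu] := eqVneq v u.
have /card_gt0P[w] : 0 < #|~: [set u; v]|.
  rewrite -(ltn_add2l #|[set u; v]|) cardsC addn0 cards2; apply: leq_trans T3.
  by case: (u != v).
rewrite !inE negb_or => /andP[wu wv].
(* The third point [w] yields an even permutation taking [u] to [v]. *)
have: tperm u v * tperm u w \in 'Alt_T.
  by rewrite Alt_even odd_permM !odd_tperm eq_sym vu eq_sym wu.
move/(subsetP AltA)/astabs_act=> /(_ u).
by rewrite /= apermE permM tpermL tpermD ?uA // eq_sym.
Qed.

(** By transitivity a single point meets every nonempty stable set, so Ree's inequality applies with
    [#|R| = 1]; [z] and its inverse [x * y] have equally many cycles. *)
Lemma card_porbits_Alt x y z : 2 < #|T| -> x * y * z = 1 ->
    <<[set x; y; z]>> = 'Alt_T ->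
  #|porbits x| + #|porbits y| + #|porbits z| <= #|T| + 2.
Proof.
move=> T3 xyz genA.
have -> : z = (x * y)^-1 by apply/esym/eqP; rewrite eq_invg_mul xyz.
have /card_gt0P[a _] : 0 < #|T| by lia.
rewrite porbitsV; have := card_porbits_Ree (R := [set a]) (s := y) (t := x); rewrite cards1; apply.
move=> A nA yA xA; suff ->: A = setT.
  by rewrite -setI_eq0 setTI; apply/set0Pn; exists a; rewrite inE.
apply: Alt_stable_setT => //; rewrite -genA gen_subG !subUset !sub1set xA yA /=.
have ->: z = (x * y)^-1 by apply/esym/eqP; rewrite eq_invg_mul xyz.
by rewrite groupV groupM.
Qed.

End Permutations.

(** * Hurwitz triples in the alternating group *)

Lemma hurwitz_Alt_counts n (x y z : {perm 'I_n}) :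
  hurwitz_triple 'Alt_('I_n)%G x y z ->
  [/\ 6 < n, #|porbits x| + #|porbits y| + #|porbits z| <= n + 2,
      odd #|porbits x| = odd n,
      (2 * #|porbits x| = n + nfix x)%N /\ (3 * #|porbits y| = n + 2 * nfix y)%N &
      (7 * #|porbits z| = n + 6 * nfix z)%N /\ nfix z < n].
Proof.
case=> -[Ax Ay Az] [ox oy oz] xyz genA.
have x2 : x ^+ 2 = 1 by rewrite -ox expg_order.
have y3 : y ^+ 3 = 1 by rewrite -oy expg_order.
have z7 : z ^+ 7 = 1 by rewrite -oz expg_order.
have := card_porbits_prime (isT : prime 2) x2.
have := card_porbits_prime (isT : prime 3) y3.
have := card_porbits_prime (isT : prime 7) z7.
rewrite card_ord mul1n => cz cy cx.
have lt_z : nfix z < n.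
  rewrite ltnNge; apply/negP=> le_n; suff z1 : z = 1 by rewrite z1 order1 in oz.
  apply/permP=> u; rewrite perm1; apply/eqP.
  have: [set v | z v == v] == setT by rewrite eqEcard subsetT cardsT card_ord.
  by move/eqP/setP/(_ u); rewrite !inE.
(* The [n - nfix z] points moved by [z] fall into 7-cycles, and there is at least one. *)
have n6 : 6 < n by have := nfix_le_porbits (isT : prime 7) z7; lia.
split=> //.
- by have := @card_porbits_Alt 'I_n x y z; rewrite card_ord; apply=> //; lia.
- by move: Ax; rewrite Alt_even /odd_perm card_ord; case: (odd n); case: (odd _).
Qed.

Lemma nfix_neq n p (s t : {perm 'I_n}) (S T : {set {perm 'I_n}}) :
    powers_not_conjugate 'Alt_('I_n)%G S T -> s \in S -> t \in T ->
    prime p -> #[s] = p -> #[t] = p ->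
    1 < nfix s \/ odd p /\ (nfix s).+1 < #|porbits s| ->
  nfix s <> nfix t.
Proof.
move=> notconj sS tT p_pr os ot big eq_fix.
have sp : s ^+ p = 1 by rewrite -os expg_order.
have tp : t ^+ p = 1 by rewrite -ot expg_order.
have s1 : s ^+ 1 != 1.
  by apply: contraTneq p_pr; rewrite expg1 -os => ->; rewrite order1.
by move: (notconj s t sS tT 1%N 1%N s1); rewrite !expg1 (Alt_class_prime p_pr sp tp).
Qed.

Theorem theorem3p1 (n : nat) :
  doubly_hurwitz_beauville ('Alt_('I_n))%G -> 168 <= n.
Proof.
move=> [x1 [y1 [z1 [x2 [y2 [z2 [H1 H2 notconj]]]]]]].
have [n6 le1 par1 [cx1 cy1] [cz1 ltz1]] := @hurwitz_Alt_counts _ _ _ _ H1.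
have [_ le2 par2 [cx2 cy2] [cz2 ltz2]] := @hurwitz_Alt_counts _ _ _ _ H2.
have [_ [ox1 oy1 oz1] _ _] := H1; have [_ [ox2 oy2 oz2] _ _] := H2.
have neq p s t sS tT := @nfix_neq n p s t _ _ notconj sS tT.
have neqx : 1 < nfix x1 -> nfix x1 <> nfix x2.
  by move=> lt1; apply: (neq 2) => //; rewrite ?inE ?eqxx //; left.
have neqy : 1 < nfix y1 -> nfix y1 <> nfix y2.
  by move=> lt1; apply: (neq 3) => //; rewrite ?inE ?eqxx ?orbT //; left.
have neqz : 1 < nfix z1 \/ (nfix z1).+1 < #|porbits z1| -> nfix z1 <> nfix z2.
  move=> big; apply: (neq 7) => //; rewrite ?inE ?eqxx ?orbT //.
  by case: big; [left | right].
have [eqz | neq12] := eqVneq (nfix z1) (nfix z2); last by lia.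
(* By [neqz], [z1] has at most one fixed point and at most one 7-cycle. *)
have [n7 | n8] : n = 7 \/ n = 8 by lia.
(* Each [z] is a single cycle and each [y] has at least 3, so each [x] has at most 5; parity
   excludes 4. *)
- have [ax1 ax2] : nfix x1 = 3 /\ nfix x2 = 3 by lia.
  by lia.
(* Each [z] has 2 cycles and each [x] at least 4, leaving at most 4 for each [y]. The bound also
   makes [x1] fixed-point-free, so [neqx] says nothing and the [y] decide. *)
- have [by1 by2] : nfix y1 = 2 /\ nfix y2 = 2 by lia.
  by lia.
Qed.
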